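(* Let $N=r+1$, $q$ a parameter, and for $i\in[1,N]$ let $\Gamma_i$ be the operator $(\Gamma_if)(x_1,\dots,x_N)=f(x_1,\dots,x_{i-1},qx_i,x_{i+1},\dots,x_N)$. For $\alpha\in[1,N]$ and $n\in\mathbb{Z}$ define the difference operator $$M_{\alpha,n}=\sum_{I\subset[1,N],\,|I|=\alpha}x_I^{\,n}\prod_{i\in I,\ j\notin I}\frac{x_i}{x_i-x_j}\,\Gamma_I,\qquad x_I=\prod_{i\in I}x_i,\ \Gamma_I=\prod_{i\in I}\Gamma_i,$$ and set $M_{0,n}=1$. Then $M_{N,n}=A^n\Delta$ with $A=x_1\cdots x_N$, $\Delta=\Gamma_1\cdots\Gamma_N$, and the operators satisfy the quantum (''M-system'') relations $$M_{\alpha,n}M_{\beta,n+1}=q^{\min(\alpha,\beta)}M_{\beta,n+1}M_{\alpha,n}\quad(\alpha,\beta\in[1,r],\ n\in\mathbb{Z}),$$ $$q^{\alpha}M_{\alpha,n+1}M_{\alpha,n-1}=(M_{\alpha,n})^2-M_{\alpha+1,n}M_{\alpha-1,n}\quad(\alpha\in[1,r],\ n\in\mathbb{Z}).$$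
   Context: The operators act on the ring of symmetric functions (symmetric rational/Laurent polynomial functions) in $x_1,\dots,x_N$. This M-system is a rescaled form of the $A_r$ quantum Q-system, which quantizes the Q-system $Q_{\alpha,n+1}Q_{\alpha,n-1}=Q_{\alpha,n}^2-Q_{\alpha+1,n}Q_{\alpha-1,n}$ satisfied by Kirillov–Reshetikhin characters. *)

(* Defs.v *)
From HB Require Import structures.
From mathcomp Require Import all_boot all_order all_algebra all_fingroup.
Set Implicit Arguments. Unset Strict Implicit. Unset Printing Implicit Defensive.
Import Order.TTheory GRing.Theory Num.Theory.
Local Open Scope ring_scope.

Definition pt (N : nat) (K : fieldType) := {ffun 'I_N -> K}.
Definition fn (N : nat) (K : fieldType) := pt N K -> K.

Definition symmetric_fn (N : nat) (K : fieldType) (f : fn N K) : Prop :=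
  forall (s : 'S_N) (x : pt N K), f [ffun i => x (s i)] = f x.

Definition GammaI (N : nat) (K : fieldType) (q : K) (I : {set 'I_N})
  (f : fn N K) : fn N K :=
  fun x => f [ffun i => if i \in I then q * x i else x i].

Definition Mop (N : nat) (K : fieldType) (q : K) (alpha : nat) (n : int)
  (f : fn N K) : fn N K :=
  fun x => \sum_(I : {set 'I_N} | #|I| == alpha)
      (\prod_(i in I) x i) ^ n
      * (\prod_(i in I) \prod_(j in ~: I) (x i / (x i - x j)))
      * GammaI q I f x.

(* Genericity of the point x: the x_i are nonzero and all denominators
   q^a x_i - q^b x_j (a,b in {0,1}, i <> j) occurring in the operators and
   their products are nonzero. *)
Definition generic (N : nat) (K : fieldType) (q : K) (x : pt N K) : Prop :=
  (forall i, x i != 0) /\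
  (forall i j : 'I_N, i != j -> forall a b : bool,
       q ^+ a * x i != q ^+ b * x j).

(* Main.v *)
(* The coefficient of [Gamma_I Gamma_J] in a product of two operators depends on
   [I] and [J], beyond [S = I :&: J] and the symmetric difference [D], only
   through the splitting of [D] into [A = I :\: J] and [B = J :\: I]. Both
   relations thus reduce to identities, for each [D], between sums over such
   splittings of x_A^u x_B^v prod_(i in A, j in B) 1 / ((x_i - x_j) (x_j - q x_i)).
   As a function of one variable X = x_z, such a sum multiplied by
   prod_j (X - x_j) (x_j - q X) (X - q x_j) is a polynomial of degree less than
   3 (|D| - 1). It vanishes at X = x_j, and its values at X = q x_j and X = x_j / q
   are multiples of the same sum for D minus {z, j}; induction on |D| then
   provides 3 (|D| - 1) roots. These are distinct only for very generic q and x
   (q = 1 is allowed in the theorem), so the identity is first proved for the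
   deformed parameters q + t and x_i + t^(3 i + 3) over K(t), cleared of
   denominators, and specialised at t = 0. *)
Require Import Defs.
From HB Require Import structures.
From mathcomp Require Import all_boot all_order all_algebra all_fingroup.
From mathcomp Require Import ring zify.
Set Implicit Arguments.
Unset Strict Implicit.
Unset Printing Implicit Defensive.
Import Order.TTheory GRing.Theory Num.Theory.
Local Open Scope ring_scope.

(** * Sums over the subsets of a set with one element adjoined *)

Section SubsetSums.
Variables (R : nmodType) (T : finType).

(** The subsets are separated by whether they contain [k]. [F] also receives the complement, so [k]
    can be followed to either side of the splitting. *)
Lemma big_subset_setU1 (k : T) (E : {set T}) (p : nat)
    (F : {set T} -> {set T} -> R) : k \notin E ->
  \sum_(A : {set T} | (A \subset k |: E) && (#|A| == p)) F A ((k |: E) :\: A) =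
  \sum_(A : {set T} | (A \subset E) && (#|A| == p)) F A (k |: (E :\: A)) +
  \sum_(A : {set T} | (A \subset E) && (#|A|.+1 == p)) F (k |: A) (E :\: A).
Proof.
move=> kE; have notk (A : {set T}) : A \subset E -> k \notin A.
  by move=> sAE; apply: contraNN kE => /(subsetP sAE).
rewrite (bigID (fun A : {set T} => k \in A)) /= addrC; congr (_ + _).
  apply: eq_big => [A | A /andP[/andP[sA _] kA]].
    apply/idP/idP => [/andP[/andP[sA ->]] kA | /andP[sA ->]].
      by rewrite andbT -(setU1K kE) subsetD1 sA.
    by rewrite notk // (subset_trans sA) // subsetUr.
  congr (F A _); apply/setP=> i; rewrite !inE.
  by case: eqP => [->|] //=; rewrite kA.
rewrite (reindex_onto (fun A => k |: A) (fun A => A :\ k)); last first.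
  by move=> A /andP[_ kA]; rewrite setD1K.
apply: eq_big => [A | A /andP[/andP[/andP[sA _] _] /eqP eA]].
  rewrite setU11 andbT.
  apply/idP/idP => [/andP[/andP[sA cA] /eqP eA] | /andP[sA cA]].
    have kA : k \notin A by rewrite -eA setD11.
    rewrite cardsU1 kA add1n in cA; rewrite cA andbT -(setU1K kE) subsetD1 kA andbT.
    by rewrite (subset_trans _ sA) // subsetUr.
  by rewrite cardsU1 notk // add1n cA setUS //= setU1K ?notk ?eqxx.
congr (F _ _); apply/setP=> i; rewrite !inE.
by case: eqP => [->|] //=; rewrite (negPf kE) andbF.
Qed.

End SubsetSums.

Section Pole.
Variables (R : comNzRingType) (T : finType).

(** The first factor is the denominator from the outer operator, with [i] chosen and [j] not. The
    second comes from the inner operator, with [j] chosen and [i] not, after [x i] has become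
    [q * x i]. *)
Definition pole (q : R) (x : T -> R) (i j : T) := (x i - x j) * (x j - q * x i).

End Pole.

(** * Sums over splittings of a set, for generic parameters *)

Section Interpolation.
Variables (L : fieldType) (T : finType) (q : L) (x : T -> L).
Implicit Types (A B D E : {set T}) (i j k : T) (y : L).

Local Notation pole_ := (pole q x).

Definition bterm u v A B :=
  (\prod_(i in A) x i) ^+ u * (\prod_(j in B) x j) ^+ v *
  \prod_(i in A) \prod_(j in B) (pole_ i j)^-1.

Definition bsum D p u v :=
  \sum_(A : {set T} | (A \subset D) && (#|A| == p)) bterm u v A (D :\: A).

Lemma bterm_setU1l u v k A B : k \notin A ->
  bterm u v (k |: A) B =
  x k ^+ u * (\prod_(j in B) (pole_ k j)^-1) * bterm u v A B.
Proof. by move=> kA; rewrite /bterm !big_setU1 //= exprMn; ring. Qed.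

Lemma bterm_setU1r u v k A B : k \notin B ->
  bterm u v A (k |: B) =
  x k ^+ v * (\prod_(i in A) (pole_ i k)^-1) * bterm u v A B.
Proof.
move=> kB; rewrite /bterm big_setU1 //= exprMn.
have -> : \prod_(i in A) \prod_(j in k |: B) (pole_ i j)^-1 =
    (\prod_(i in A) (pole_ i k)^-1) * \prod_(i in A) \prod_(j in B) (pole_ i j)^-1.
  by rewrite -big_split; apply: eq_bigr => i _; rewrite big_setU1.
ring.
Qed.

Lemma bsum0 D u v : bsum D 0 u v = (\prod_(i in D) x i) ^+ v.
Proof.
rewrite /bsum (big_pred1 set0) => [|A].
  by rewrite /bterm setD0 !big_set0 expr1n mul1r mulr1.
by rewrite /= cards_eq0; case: (eqVneq A set0) => [->|]; rewrite ?sub0set ?andbF.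
Qed.

Lemma bsum_card D u v : bsum D #|D| u v = (\prod_(i in D) x i) ^+ u.
Proof.
rewrite /bsum (big_pred1 D) => [|A].
  rewrite /bterm setDv big_set0 expr1n mulr1 [X in _ * X]big1 ?mulr1 // => i _.
  by rewrite big_set0.
rewrite /= eqEcard; apply: andb_id2l => sA.
by rewrite eqn_leq subset_leq_card.
Qed.

Lemma bsum_pair a b u v : a != b -> bsum [set a; b] 1 u v =
  x b ^+ u * x a ^+ v / pole_ b a + x a ^+ u * x b ^+ v / pole_ a b.
Proof.
move=> nab; have ab : a \notin [set b] by rewrite inE.
rewrite /bsum big_subset_setU1 //; congr (_ + _).
  rewrite (big_pred1 [set b]) => [|A].
    by rewrite /bterm setDv setU0 !big_set1.
  rewrite /= subset1; case: (eqVneq A [set b]) => [->|_] /=; first by rewrite cards1.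
  by case: (eqVneq A set0) => // ->; rewrite cards0.
rewrite (big_pred1 set0) => [|A].
  by rewrite /bterm setD0 setU0 !big_set1.
by rewrite /= eqSS cards_eq0; case: (eqVneq A set0) => [->|]; rewrite ?sub0set ?andbF.
Qed.

(** Every splitting has the common factor x_A x_B = x_D. *)
Lemma bsum_shift D p u v :
  bsum D p u.+1 v.+1 = (\prod_(i in D) x i) * bsum D p u v.
Proof.
rewrite /bsum big_distrr /=; apply: eq_bigr => A /andP[sA _].
rewrite /bterm [\prod_(i in D) _](big_setID A) /= (setIidPr sA) !exprS; ring.
Qed.

Lemma bsum_shiftn D p u v t :
  bsum D p (u + t) (v + t) = (\prod_(i in D) x i) ^+ t * bsum D p u v.
Proof.
elim: t => [|t IHt]; first by rewrite !addn0 mul1r.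
by rewrite !addnS bsum_shift IHt mulrA -exprS.
Qed.

(** * Numerators as polynomials in one variable, with degree bounds *)

Definition cubic i : {poly L} :=
  ('X - (x i)%:P) * ((x i)%:P - q *: 'X) * ('X - (q * x i)%:P).

(** A new element with variable ['X] is put on the side of [A]. Each [cubic] is a common denominator
    for both possible positions of that element; on the side of [B], dividing it by the pole leaves
    the linear factor. [poly2] puts the new element on the side of [B]. *)
Definition poly1 u v A B : {poly L} :=
  (bterm u v A B)%:P * 'X^u * (\prod_(i in A) cubic i) *
  \prod_(j in B) ('X - (q * x j)%:P).

Definition poly2 u v A B : {poly L} :=
  (bterm u v A B)%:P * 'X^v * (\prod_(i in A) (q *: 'X - (x i)%:P)) *
  \prod_(j in B) cubic j.

Definition bpoly D p u v : {poly L} :=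
  \sum_(A : {set T} | (A \subset D) && (#|A| == p)) poly1 u v A (D :\: A) +
  \sum_(A : {set T} | (A \subset D) && (#|A| == p.+1)) poly2 u v A (D :\: A).

Lemma horner_cubic i y :
  (cubic i).[y] = (y - x i) * (x i - q * y) * (y - q * x i).
Proof. by rewrite /cubic !hornerE. Qed.

Lemma horner_poly1 u v A B y :
  (poly1 u v A B).[y] = bterm u v A B * y ^+ u * (\prod_(i in A) (cubic i).[y])
    * \prod_(j in B) (y - q * x j).
Proof.
rewrite /poly1 !hornerM !horner_prod hornerXn hornerC.
by congr (_ * _); apply: eq_bigr => j _; rewrite !hornerE.
Qed.

Lemma horner_poly2 u v A B y :
  (poly2 u v A B).[y] = bterm u v A B * y ^+ v *
    (\prod_(i in A) (q * y - x i)) * \prod_(j in B) (cubic j).[y].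
Proof.
rewrite /poly2 !hornerM !horner_prod hornerXn hornerC.
by congr (_ * _ * _); apply: eq_bigr => j _; rewrite !hornerE.
Qed.

Lemma size_prod_le (D : {set T}) (F : T -> {poly L}) d :
  (forall i, size (F i) <= d.+1)%N ->
  (size (\prod_(i in D) F i)%R <= (d * #|D|).+1)%N.
Proof.
move=> sF; apply: leq_trans (size_poly_prod_leq _ _) _.
have : (\sum_(i in D) size (F i) <= #|D| * d.+1)%N.
  by rewrite -sum_nat_const; apply: leq_sum.
have -> : #|(fun i => i \in D)| = #|D| by apply: eq_card.
lia.
Qed.

Lemma size_linear (a b : L) : (size (a *: 'X + b%:P)%R <= 2)%N.
Proof.
apply: leq_trans (size_polyD _ _) _; rewrite geq_max.
rewrite (leq_trans (size_scale_leq _ _)) ?size_polyX //.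
by rewrite (leq_trans (size_polyC_leq1 _)).
Qed.

Lemma size_mul_leS (f g : {poly L}) a b :
  (size f <= a.+1)%N -> (size g <= b.+1)%N -> (size (f * g)%R <= (a + b).+1)%N.
Proof.
have := size_polyMleq f g; move: (size f) (size g) (size _) => sf sg sfg; lia.
Qed.

Lemma size_cubic i : (size (cubic i) <= 4)%N.
Proof.
have sX (c : L) : (size ('X - c%:P)%R <= 2)%N by rewrite size_XsubC.
apply: (size_mul_leS (a := 2) (b := 1)) => //.
apply: (size_mul_leS (a := 1) (b := 1)) => //.
by rewrite addrC -scaleNr size_linear.
Qed.

Lemma size_poly1 u v A B : (size (poly1 u v A B) <= (u + 3 * #|A| + #|B|).+1)%N.
Proof.
rewrite -{2}[u]add0n -[#|B|]mul1n.
apply: size_mul_leS; last by apply: size_prod_le => j; rewrite size_XsubC.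
apply: size_mul_leS; last exact: size_prod_le size_cubic.
by apply: size_mul_leS; rewrite ?size_polyC_leq1 ?size_polyXn.
Qed.

Lemma size_poly2 u v A B : (size (poly2 u v A B) <= (v + #|A| + 3 * #|B|).+1)%N.
Proof.
rewrite -{2}[v]add0n -[#|A|]mul1n.
apply: size_mul_leS; last exact: size_prod_le size_cubic.
apply: size_mul_leS; last first.
  by apply: size_prod_le => i; rewrite -polyCN size_linear.
by apply: size_mul_leS; rewrite ?size_polyC_leq1 ?size_polyXn.
Qed.

(** The bounds on [u] and [v] are exactly what makes u + 3p + (s + 1) and v + (p + 1) + 3s at most
    3(p + s) + 2, one below the number of roots found later. *)
Lemma size_bpoly D p s u v : #|D| = (p + s).+1 ->
  (u <= 2 * s + 1)%N -> (v <= 2 * p + 1)%N ->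
  (size (bpoly D p u v) <= 3 * #|D|)%N.
Proof.
move=> cD us vp; apply: leq_trans (size_polyD _ _) _; rewrite geq_max.
have cB A : A \subset D -> (#|D :\: A| = #|D| - #|A|)%N.
  by move=> sA; rewrite cardsDS.
apply/andP; split; apply: leq_trans (size_sum _ _ _) _;
  apply/bigmax_leqP => A /andP[sA /eqP cA].
- apply: leq_trans (size_poly1 _ _ _ _) _; rewrite cB //; lia.
- apply: leq_trans (size_poly2 _ _ _ _) _; rewrite cB //; lia.
Qed.

(* The numbers [q^a * x i] with [a < 3] are the points [x i], [q x i], [x i / q]
   up to a common factor [q]. *)
Hypothesis x_inj : injective (fun t : T * 'I_3 => q ^+ t.2 * x t.1).

Lemma generic_q_neq0 (i : T) : q != 0.
Proof.
apply/eqP=> q0; have := @x_inj (i, @Ordinal 3 1 isT) (i, @Ordinal 3 2 isT).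
by rewrite /= q0 !expr0n /= !mul0r => /(_ erefl).
Qed.

Lemma generic_sub_neq0 i j : i != j -> x i - x j != 0.
Proof.
move=> nij; rewrite subr_eq0; apply: contra nij => /eqP e.
by have := @x_inj (i, ord0) (j, ord0); rewrite /= e => /(_ erefl) [->].
Qed.

Lemma generic_subq_neq0 i j : i != j -> x i - q * x j != 0.
Proof.
move=> nij; rewrite subr_eq0; apply: contra nij => /eqP e.
have := @x_inj (i, @Ordinal 3 0 isT) (j, @Ordinal 3 1 isT).
by rewrite /= e expr0 expr1 mul1r => /(_ erefl) [->].
Qed.

Lemma pole_neq0 i j : i != j -> pole_ i j != 0.
Proof.
by move=> nij; rewrite mulf_neq0 ?generic_sub_neq0 ?generic_subq_neq0 // eq_sym.
Qed.

Lemma pole_cubicl k j : k != j -> (pole_ k j)^-1 * (cubic j).[x k] = x k - q * x j.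
Proof.
move=> nkj; have := pole_neq0 nkj; rewrite horner_cubic => np.
by apply: (mulfI np); rewrite mulVKf // /pole; ring.
Qed.

Lemma pole_cubicr i k : i != k -> (pole_ i k)^-1 * (cubic i).[x k] = q * x k - x i.
Proof.
move=> nik; have := pole_neq0 nik; rewrite horner_cubic => np.
by apply: (mulfI np); rewrite mulVKf // /pole; ring.
Qed.

Lemma pole_cubicql k j : k != j ->
  (pole_ k j)^-1 * (cubic j).[q * x k] = q * (q * (q * x k) - x j).
Proof.
move=> nkj; have := pole_neq0 nkj; rewrite horner_cubic => np.
by apply: (mulfI np); rewrite mulVKf // /pole; ring.
Qed.

Lemma pole_cubicqr i k y : i != k -> q * y = x k ->
  (pole_ i k)^-1 * (cubic i).[y] = q^-1 * (y - q * x i).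
Proof.
move=> nik e; have := pole_neq0 nik; rewrite horner_cubic => np.
have q0 := generic_q_neq0 i.
by apply: (mulfI np); rewrite mulVKf // /pole -e; field.
Qed.

(** The element [z] joins either side of a splitting of [D], and its poles cancel against the cubics
    evaluated at [x z]. *)
Lemma bsum_bpoly z D p u v : z \notin D ->
  bsum (z |: D) p.+1 u v * \prod_(i in D) (cubic i).[x z] = (bpoly D p u v).[x z].
Proof.
move=> zD; have nz i : i \in D -> i != z by apply: contraTneq => ->.
rewrite /bsum big_subset_setU1 // /bpoly hornerD !horner_sum addrC mulrDl !big_distrl /=.
congr (_ + _); apply: eq_bigr => A /andP[sA _].
  rewrite bterm_setU1l; last by apply: contraNN zD => /(subsetP sA).
  rewrite horner_poly1 [\prod_(i in D) _](big_setID A) /= (setIidPr sA).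
  have -> : \prod_(j in D :\: A) (x z - q * x j) =
      (\prod_(j in D :\: A) (pole_ z j)^-1) * \prod_(j in D :\: A) (cubic j).[x z].
    rewrite -big_split; apply: eq_bigr => j; rewrite inE => /andP[_ /nz jz].
    by rewrite /= pole_cubicl // eq_sym.
  ring.
rewrite bterm_setU1r ?inE ?(negPf zD) ?andbF //.
rewrite horner_poly2 [\prod_(i in D) _](big_setID A) /= (setIidPr sA).
have -> : \prod_(i in A) (q * x z - x i) =
    (\prod_(i in A) (pole_ i z)^-1) * \prod_(i in A) (cubic i).[x z].
  rewrite -big_split; apply: eq_bigr => i /(subsetP sA)/nz iz.
  by rewrite /= pole_cubicr.
ring.
Qed.


(** * Values of the numerator at the interpolation points *)

Lemma horner_bpoly_setU1 k E p u v y : k \notin E ->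
  (bpoly (k |: E) p u v).[y] =
  \sum_(A : {set T} | (A \subset E) && (#|A| == p))
     ((poly1 u v A (k |: (E :\: A))).[y] + (poly2 u v (k |: A) (E :\: A)).[y])
  + \sum_(A : {set T} | (A \subset E) && (#|A|.+1 == p))
     (poly1 u v (k |: A) (E :\: A)).[y]
  + \sum_(A : {set T} | (A \subset E) && (#|A| == p.+1))
     (poly2 u v A (k |: (E :\: A))).[y].
Proof.
move=> kE; rewrite /bpoly hornerD !horner_sum.
rewrite (big_subset_setU1 p (fun A B => (poly1 u v A B).[y])) //.
rewrite (big_subset_setU1 p.+1 (fun A B => (poly2 u v A B).[y])) //.
rewrite big_split /=.
under [X in _ + (_ + X)]eq_bigl do rewrite eqSS.
by rewrite -!addrA; congr (_ + _); rewrite [LHS]addrA [LHS]addrC.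
Qed.

Lemma horner_poly1_setU1l u v k A B y : k \notin A -> (cubic k).[y] = 0 ->
  (poly1 u v (k |: A) B).[y] = 0.
Proof. by move=> kA ck; rewrite horner_poly1 big_setU1 //= ck !(mul0r, mulr0). Qed.

Lemma horner_poly2_setU1r u v k A B y : k \notin B -> (cubic k).[y] = 0 ->
  (poly2 u v A (k |: B)).[y] = 0.
Proof.
by move=> kB ck; rewrite horner_poly2 [X in _ * X]big_setU1 //= ck !(mul0r, mulr0).
Qed.

Lemma horner_poly1_setU1r u v k A B y : k \notin B -> y = q * x k ->
  (poly1 u v A (k |: B)).[y] = 0.
Proof.
by move=> kB ->; rewrite horner_poly1 (big_setU1 _ kB) /= subrr !(mul0r, mulr0).
Qed.

Lemma horner_poly2_setU1l u v k A B y : k \notin A -> q * y = x k ->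
  (poly2 u v (k |: A) B).[y] = 0.
Proof.
by move=> kA e; rewrite horner_poly2 (big_setU1 _ kA) /= e subrr !(mul0r, mulr0).
Qed.

(** When [k] and the new element lie on the same side, [cubic k] remains as a factor. The surviving
    terms have them on opposite sides and are paired over the same [A]. *)
Lemma horner_bpoly_setU1_cubic k E p u v y : k \notin E -> (cubic k).[y] = 0 ->
  (bpoly (k |: E) p u v).[y] =
  \sum_(A : {set T} | (A \subset E) && (#|A| == p))
     ((poly1 u v A (k |: (E :\: A))).[y] + (poly2 u v (k |: A) (E :\: A)).[y]).
Proof.
move=> kE ck; rewrite horner_bpoly_setU1 // [X in _ + X + _]big1 => [|A /andP[sA _]].
  rewrite [X in _ + X]big1 ?addr0 // => A _.
  by rewrite horner_poly2_setU1r // inE (negPf kE) andbF.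
by rewrite horner_poly1_setU1l //; apply: contraNN kE => /(subsetP sA).
Qed.

(** At [x k] the new element and [k] have equal variables. Exchanging them matches the two terms of
    each pair up to sign, the sign being that of [x k - q * x k] against [q * x k - x k]. *)
Lemma bpoly_root k E p u v : k \notin E -> (bpoly (k |: E) p u v).[x k] = 0.
Proof.
move=> kE; have nk i : i \in E -> i != k by apply: contraTneq => ->.
rewrite horner_bpoly_setU1_cubic // ?horner_cubic ?subrr ?mul0r //.
apply: big1 => A /andP[sA _].
have kA : k \notin A by apply: contraNN kE => /(subsetP sA).
have kB : k \notin E :\: A by rewrite inE (negPf kE) andbF.
rewrite horner_poly1 horner_poly2 bterm_setU1l // bterm_setU1r //.
rewrite (big_setU1 _ kA) (big_setU1 _ kB) /=.
have -> : \prod_(j in E :\: A) (x k - q * x j) =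
    (\prod_(j in E :\: A) (pole_ k j)^-1) * \prod_(j in E :\: A) (cubic j).[x k].
  rewrite -big_split; apply: eq_bigr => j; rewrite inE => /andP[_ /nk jk].
  by rewrite /= pole_cubicl // eq_sym.
have -> : \prod_(i in A) (q * x k - x i) =
    (\prod_(i in A) (pole_ i k)^-1) * \prod_(i in A) (cubic i).[x k].
  rewrite -big_split; apply: eq_bigr => i /(subsetP sA)/nk ik.
  by rewrite /= pole_cubicr.
ring.
Qed.

(** Only the terms with [k] on the left survive. The prefactor depends on [u] and [v] only through
    [u + v], so it can be taken out of a combination of sums with constant [u + v]. *)
Lemma bpoly_root_mulq k E p s u v : k \notin E -> #|E| = (p + s)%N ->
  (bpoly (k |: E) p u v).[q * x k] =
  x k ^+ (u + v) * (q * (q * x k) - x k) * (\prod_(i in E) (q * (q * x k) - x i)) *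
  (q ^+ (v + s) * bsum E p u v).
Proof.
move=> kE cE; have nk i : i \in E -> i != k by apply: contraTneq => ->.
rewrite horner_bpoly_setU1_cubic // ?horner_cubic ?subrr ?mulr0 //.
rewrite /bsum !big_distrr /=; apply: eq_bigr => A /andP[sA /eqP cA].
have kA : k \notin A by apply: contraNN kE => /(subsetP sA).
have kB : k \notin E :\: A by rewrite inE (negPf kE) andbF.
have cB : #|E :\: A| = s by rewrite cardsDS // cE cA addKn.
rewrite horner_poly1_setU1r // add0r.
rewrite horner_poly2 bterm_setU1l // (big_setU1 _ kA) /=.
rewrite [\prod_(i in E) _](big_setID A) /= (setIidPr sA).
(* Each of the [s] elements of the right side contributes one factor [q]; the rest has the same
   shape as the factors over [A], so they combine into a product over [E]. *)
have eB : (\prod_(j in E :\: A) (pole_ k j)^-1) * \prod_(j in E :\: A) (cubic j).[q * x k]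
   = q ^+ s * \prod_(j in E :\: A) (q * (q * x k) - x j).
  rewrite -big_split -cB -prodr_const -big_split /=; apply: eq_bigr => j.
  by rewrite inE => /andP[_ /nk jk]; rewrite pole_cubicql // eq_sym.
transitivity ((\prod_(j in E :\: A) (pole_ k j)^-1) *
    (\prod_(j in E :\: A) (cubic j).[q * x k]) *
  (x k ^+ u * bterm u v A (E :\: A) * (q * x k) ^+ v * (q * (q * x k) - x k) *
   \prod_(i in A) (q * (q * x k) - x i))); first by ring.
rewrite eB exprMn !exprD; ring.
Qed.

(** Now only the terms with [k] on the right survive. The weight [q ^+ (v + s)] is the same as at
    [q * x k], so one hypothesis on [E] serves both points. *)
Lemma bpoly_root_divq k E p s u v y : k \notin E -> #|E| = (p + s)%N -> q * y = x k ->
  (bpoly (k |: E) p u v).[y] =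
  y ^+ (u + v) * (y - q * x k) * (\prod_(i in E) (q^-1 * (y - q * x i))) *
  (q ^+ (v + s) * bsum E p u v).
Proof.
move=> kE cE ey; have nk i : i \in E -> i != k by apply: contraTneq => ->.
have q0 := generic_q_neq0 k.
rewrite horner_bpoly_setU1_cubic // ?horner_cubic ?ey ?subrr ?mulr0 ?mul0r //.
rewrite /bsum !big_distrr /=; apply: eq_bigr => A /andP[sA /eqP cA].
have kA : k \notin A by apply: contraNN kE => /(subsetP sA).
have kB : k \notin E :\: A by rewrite inE (negPf kE) andbF.
have cB : #|E :\: A| = s by rewrite cardsDS // cE cA addKn.
rewrite horner_poly2_setU1l // addr0.
rewrite horner_poly1 bterm_setU1r // (big_setU1 _ kB) /=.
rewrite [\prod_(i in E) _](big_setID A) /= (setIidPr sA).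
have <- : (\prod_(i in A) (pole_ i k)^-1) * \prod_(i in A) (cubic i).[y]
   = \prod_(i in A) (q^-1 * (y - q * x i)).
  rewrite -big_split /=; apply: eq_bigr => j /(subsetP sA)/nk jk.
  by rewrite pole_cubicqr.
have <- : q ^+ s * \prod_(j in E :\: A) (q^-1 * (y - q * x j)) =
    \prod_(j in E :\: A) (y - q * x j).
  rewrite -cB -prodr_const -big_split /=; apply: eq_bigr => j _.
  by rewrite mulVKf.
rewrite -ey exprMn !exprD; ring.
Qed.

(** This is the induction step for both relations. One element [z] of [D] becomes the variable, and
    the combined numerator has more roots than its degree allows: three for each element of
    [D :\ z]. *)
Lemma bsum_combination_eq0 (J : finType) (c : J -> L) (p s u v : J -> nat) m D :
  (forall t, #|D| = (p t + s t).+2) ->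
  (forall t, (u t <= 2 * s t + 1)%N) -> (forall t, (v t <= 2 * p t + 1)%N) ->
  (forall t, (u t + v t)%N = m) ->
  (forall E : {set T}, (#|E|.+2 = #|D|)%N ->
     \sum_t c t * (q ^+ (v t + s t) * bsum E (p t) (u t) (v t)) = 0) ->
  \sum_t c t * bsum D (p t).+1 (u t) (v t) = 0.
Proof.
move=> cD us vp uvm IH.
have [t0 | J0] := pickP J; last by rewrite big_pred0.
have [z zD] : exists z, z \in D by apply/card_gt0P; rewrite (cD t0).
pose D' := D :\ z; have cD' : #|D| = #|D'|.+1 by rewrite (cardsD1 z) zD.
have zD' : z \notin D' by rewrite setD11.
have eD : D = z |: D' by rewrite setD1K.
have q0 := generic_q_neq0 z.
pose f := \sum_t (c t)%:P * bpoly D' (p t) (u t) (v t).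
have fE y : f.[y] = \sum_t c t * (bpoly D' (p t) (u t) (v t)).[y].
  by rewrite horner_sum; apply: eq_bigr => t _; rewrite hornerM hornerC.
have f0 : f = 0.
  pose rs := [seq q^-1 * (q ^+ t.2 * x t.1) | t : T * 'I_3 <- enum (setX D' [set: 'I_3])].
  have srs : size rs = (3 * #|D'|)%N.
    by rewrite size_map -cardE cardsX cardsT card_ord mulnC.
  apply: (@roots_geq_poly_eq0 _ _ rs).
  - apply/allP => w /mapP[[k a]]; rewrite mem_enum inE /= => /andP[kD' _] ->.
    pose E := D' :\ k; have eD' : D' = k |: E by rewrite setD1K.
    have kE : k \notin E by rewrite setD11.
    have cE : #|D'| = #|E|.+1 by rewrite (cardsD1 k) kD'.
    have cEt t : #|E| = (p t + s t)%N by have := cD t; rewrite cD' cE => -[].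
    have IHE := IH E; rewrite cD' cE in IHE; move: (IHE erefl) => {}IHE.
    (* A prefactor [b] independent of [t] comes out of the sum, leaving the vanishing combination
       for [E]. *)
    have factored y b (e : forall t, (bpoly D' (p t) (u t) (v t)).[y] =
        b * (q ^+ (v t + s t) * bsum E (p t) (u t) (v t))) : root f y.
      rewrite /root fE; under eq_bigr do rewrite e mulrCA.
      by rewrite -big_distrr /= IHE mulr0.
    case: a => -[|[|[|//]]] /= _.
    + rewrite expr0 mul1r.
      have ey : q * (q^-1 * x k) = x k by rewrite mulVKf.
      apply: factored => t; rewrite eD' (bpoly_root_divq _ _ kE (cEt t) ey).
      by rewrite uvm.
    + rewrite expr1 mulKf // /root fE big1 // => t _.
      by rewrite eD' bpoly_root // mulr0.
    + rewrite expr2 -mulrA mulKf //.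
      by apply: factored => t; rewrite eD' (bpoly_root_mulq _ _ kE (cEt t)) uvm.
  - rewrite map_inj_uniq ?enum_uniq // => a b /(mulfI (invr_neq0 q0)).
    exact: x_inj.
  - rewrite srs; apply: leq_trans (size_sum _ _ _) _; apply/bigmax_leqP => t _.
    apply: leq_trans (size_polyMleq _ _) _.
    have : (size (bpoly D' (p t) (u t) (v t)) <= 3 * #|D'|)%N.
      by apply: (@size_bpoly D' (p t) (s t)) => //; have := cD t; rewrite cD' => -[].
    have := size_polyC_leq1 (c t).
    by move: (size _) (size _) => a b; lia.
have den0 : \prod_(i in D') (cubic i).[x z] != 0.
  apply/prodf_neq0 => i iD'; have iz : z != i by apply: contraNneq zD' => ->.
  rewrite horner_cubic !mulf_neq0 ?generic_sub_neq0 ?generic_subq_neq0 //.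
  by rewrite eq_sym.
move=> _; apply/eqP; rewrite -(mulIr_eq0 _ (mulIf den0)).
apply/eqP; rewrite big_distrl /=.
transitivity f.[x z]; last by rewrite f0 horner0.
by rewrite fE; apply: eq_bigr => t _; rewrite eD -mulrA bsum_bpoly.
Qed.

(** * The two generic identities, by induction on the size of the set *)

Lemma bsum_swap_generic p s D : #|D| = (p + s)%N ->
  bsum D p s p.+1 = q ^+ minn p s * bsum D s p.+1 s.
Proof.
elim: p s D => [|p IHp] [|s] D cD.
- by rewrite min0n mul1r !bsum0 (cards0_eq cD) big_set0 expr1n.
- by rewrite min0n mul1r bsum0 -(bsum_card D 1 s.+1) cD.
- by rewrite minn0 mul1r bsum0 -(bsum_card D 0 p.+2) cD addn0.
rewrite minnSS !bsum_shift mulrCA; congr (_ * _).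
(* The weights [q ^+ (v t + s t)] of the two sums are q^(p+s+1) and q^(p+s). Their ratio [q] turns
   the exponent [minn p s] for [E] into [(minn p s).+1] for [D]. *)
have := @bsum_combination_eq0 bool (fun t => if t then 1 else - q ^+ (minn p s).+1)
  (fun t => if t then p else s) (fun t => if t then s else p)
  (fun t => if t then s else p.+1) (fun t => if t then p.+1 else s)
  (p + s).+1 D.
rewrite !big_bool /= => comb; apply/eqP; rewrite -subr_eq0; apply/eqP.
rewrite -[RHS]comb.
- by rewrite mul1r mulNr.
- by case; lia.
- by case; lia.
- by case; lia.
- by case; lia.
move=> E cE; rewrite big_bool /= IHp; last by lia.
rewrite !exprD !exprS; ring.
Qed.

Lemma bsum_exchange_generic p D : #|D| = (p.+1 + p.+1)%N ->
  q ^+ p.+1 * bsum D p.+1 2 0 = bsum D p.+1 1 1 - bsum D p.+2 0 2.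
Proof.
elim: p D => [|p IHp] D cD.
  have /cards2P[a [b [nab ->]]] : #|D| == 2 by rewrite cD.
  (* With both elements in [A] and exponent 0, the last sum is 1; an explicit rational identity in
     [x a] and [x b] is left. *)
  have := bsum_card [set a; b] 0 2; rewrite cards2 nab expr0 => ->.
  rewrite !bsum_pair //.
  have := pole_neq0 nab; have nba : b != a by rewrite eq_sym.
  have := pole_neq0 nba; rewrite /pole => ba0 ab0.
  move: (ab0) (ba0); rewrite !mulf_eq0 !negb_or => /andP[? ?] /andP[? ?].
  by field; apply/and4P.
pose nt (s : seq nat) (t : 'I_3) := nth 0%N s t.
(* The three weights are q^(p+1), q^(p+2), q^(p+2). Multiplied by the coefficients they give q^(p+2)
   times the induction hypothesis for [E]. *)
have := @bsum_combination_eq0 'I_3 (fun t => nth 0 [:: q ^+ p.+2; -1; 1] t)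
  (nt [:: p.+1; p.+1; p.+2]) (nt [:: p.+1; p.+1; p])
  (nt [:: 2; 1; 0]) (nt [:: 0; 1; 2]) 2 D.
rewrite /nt !big_ord_recl !big_ord0 /= => comb.
apply/eqP; rewrite -subr_eq0; apply/eqP; rewrite -[RHS]comb.
- ring.
- by case=> -[|[|[|//]]] _ /=; lia.
- by case=> -[|[|[|//]]] _ /=; lia.
- by case=> -[|[|[|//]]] _ /=; lia.
- by case=> -[|[|[|//]]] _ /=; lia.
move=> E cE; rewrite !big_ord_recl !big_ord0 /=.
have cE' : #|E| = (p.+1 + p.+1)%N by lia.
have -> : bsum E p.+1 1 1 = q ^+ p.+1 * bsum E p.+1 2 0 + bsum E p.+2 0 2.
  by rewrite IHp // subrK.
rewrite !exprD !exprS; ring.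
Qed.

End Interpolation.

(** * Denominator-free sums over any commutative ring *)

Section Cleared.
Variable T : finType.

(** This is [bsum] multiplied by the poles of all ordered pairs of distinct elements of [D]. Being
    polynomial, it commutes with ring morphisms, in particular with specialisation. *)
Definition csum (R : comNzRingType) (q : R) (x : T -> R) (D : {set T}) p u v :=
  \sum_(A : {set T} | (A \subset D) && (#|A| == p))
    (\prod_(i in A) x i) ^+ u * (\prod_(j in D :\: A) x j) ^+ v *
    \prod_(t : T * T | (t \in setX D D) && (t.1 != t.2) &&
              ~~ ((t.1 \in A) && (t.2 \in D :\: A))) pole q x t.1 t.2.

Lemma eq_csum (R : comNzRingType) (q : R) x y (D : {set T}) p u v :
  x =1 y -> csum q x D p u v = csum q y D p u v.
Proof.
move=> xy; apply: eq_bigr => A _; rewrite !(eq_bigr _ (fun i _ => xy i)).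
by congr (_ * _); apply: eq_bigr => t _; rewrite /pole !xy.
Qed.

Lemma rmorph_csum (R R' : comNzRingType) (f : {rmorphism R -> R'}) q x D p u v :
  f (csum q x D p u v) = csum (f q) (f \o x) D p u v.
Proof.
rewrite rmorph_sum; apply: eq_bigr => A _.
rewrite !rmorphM !rmorphXn !rmorph_prod; congr (_ * _).
by apply: eq_bigr => t _; rewrite /pole rmorphM !rmorphB rmorphM.
Qed.

Lemma bsum_csum (L : fieldType) (q : L) (x : T -> L) (D : {set T}) p u v :
  {in D &, forall i j, i != j -> pole q x i j != 0} ->
  bsum q x D p u v *
    \prod_(t : T * T | (t \in setX D D) && (t.1 != t.2)) pole q x t.1 t.2 =
  csum q x D p u v.
Proof.
move=> pole0; rewrite /bsum big_distrl /=; apply: eq_bigr => A /andP[sA _].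
rewrite /bterm -mulrA; congr (_ * _).
rewrite pair_big_dep /= [X in _ * X](bigID (fun t => (t.1 \in A) && (t.2 \in D :\: A))) /=.
rewrite mulrA [X in X * _](_ : _ = 1) ?mul1r //.
under [X in _ * X]eq_bigl => t.
  rewrite (_ : _ && _ = (t.1 \in A) && (t.2 \in D :\: A)); first over.
  case: t => i j /=; rewrite in_setX /= !inE andbC; apply: andb_idr.
  move=> /andP[iA /andP[jA jD]]; rewrite jD (subsetP sA) //=.
  by apply: contraNneq jA => <-.
rewrite -big_split /= big1 // => -[i j] /= /andP[iA]; rewrite inE => /andP[jA jD].
rewrite mulVf // pole0 // ?(subsetP sA) //.
by apply: contraNneq jA => <-.
Qed.

Lemma prod_pole_neq0 (L : fieldType) (q : L) (x : T -> L) (D : {set T}) :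
  {in D &, forall i j, i != j -> pole q x i j != 0} ->
  \prod_(t : T * T | (t \in setX D D) && (t.1 != t.2)) pole q x t.1 t.2 != 0.
Proof.
move=> pole0; apply/prodf_neq0 => -[i j] /=; rewrite in_setX => /andP[/andP[iD jD]].
exact: pole0.
Qed.

End Cleared.

(** * Deformation to generic parameters and specialisation at 0 *)

Section Deformation.
Variables (K : fieldType) (T : finType) (q : K) (x : T -> K).

Definition q_def : {poly K} := 'X + q%:P.
(** Multiples of 3 leave room for the powers of [q_def] below 3; the successor keeps the exponent
    positive, so that the value at 0 is [x i]. *)
Definition x_def (i : T) : {poly K} := 'X^(3 * (enum_rank i).+1) + (x i)%:P.

Lemma size_deformed a i :
  size (q_def ^+ a * x_def i)%R = (a + 3 * (enum_rank i).+1).+1.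
Proof.
have mq : q_def ^+ a \is monic by rewrite monic_exp // monicXaddC.
have mx : x_def i \is monic by rewrite monicXnaddC.
rewrite size_monicM ?monic_neq0 // size_XnaddC //.
have sq : size (q_def ^+ a) = a.+1.
  by rewrite /q_def -[q]opprK polyCN size_exp_XsubC.
by rewrite sq addnS.
Qed.

(** The degree [a + 3 * (enum_rank i).+1] determines [a] as its remainder modulo 3, and then [i]. *)
Lemma deformed_inj :
  injective (fun t : T * 'I_3 => tofrac q_def ^+ t.2 * tofrac (x_def t.1)).
Proof.
move=> [i a] [j b] /=; rewrite -!tofracXn -!tofracM => /eqP.
rewrite tofrac_eq => /eqP/(congr1 (fun f : {poly K} => size f)).
rewrite !size_deformed => -[e].
have digits (m n c d : nat) : (c < 3)%N -> (d < 3)%N ->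
  (c + 3 * m.+1 = d + 3 * n.+1)%N -> c = d /\ m = n by lia.
have [eab eij] := digits _ _ _ _ (ltn_ord a) (ltn_ord b) e.
by congr (_, _); [apply: enum_rank_inj|]; apply: val_inj.
Qed.

Lemma csum_deformed (D : {set T}) p u v :
  (csum q_def x_def D p u v).[0] = csum q x D p u v.
Proof.
rewrite -horner_evalE rmorph_csum /= /horner_eval.
have -> : q_def.[0] = q by rewrite /q_def !hornerE.
apply: eq_csum => i /=; rewrite /x_def hornerD hornerXn hornerC.
by rewrite expr0n add0r.
Qed.

Lemma csum_frac (D : {set T}) p u v :
  tofrac (csum q_def x_def D p u v) =
  bsum (tofrac q_def) (@tofrac _ \o x_def) D p u v *
    \prod_(t : T * T | (t \in setX D D) && (t.1 != t.2))
      pole (tofrac q_def) (@tofrac _ \o x_def) t.1 t.2.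
Proof.
rewrite bsum_csum ?rmorph_csum // => i j _ _ nij.
exact: pole_neq0 deformed_inj _ _ nij.
Qed.

(** The deformed identity holds in the fraction field, hence already between polynomials, where it
    can be evaluated at 0. *)
Lemma csum_swap (D : {set T}) p s : #|D| = (p + s)%N ->
  csum q x D p s p.+1 = q ^+ minn p s * csum q x D s p.+1 s.
Proof.
move=> cD; have : csum q_def x_def D p s p.+1 =
    q_def ^+ minn p s * csum q_def x_def D s p.+1 s.
  apply/eqP; rewrite -tofrac_eq tofracM tofracXn !csum_frac mulrA.
  by rewrite (bsum_swap_generic deformed_inj cD).
move/(congr1 (fun f => f.[0])); rewrite hornerM horner_exp !csum_deformed.
by rewrite /q_def !hornerE.
Qed.

Lemma csum_exchange (D : {set T}) p : #|D| = (p.+1 + p.+1)%N ->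
  q ^+ p.+1 * csum q x D p.+1 2 0 = csum q x D p.+1 1 1 - csum q x D p.+2 0 2.
Proof.
move=> cD; have : q_def ^+ p.+1 * csum q_def x_def D p.+1 2 0 =
    csum q_def x_def D p.+1 1 1 - csum q_def x_def D p.+2 0 2.
  apply/eqP; rewrite -tofrac_eq tofracB tofracM tofracXn !csum_frac mulrA.
  by rewrite (bsum_exchange_generic deformed_inj cD) mulrBl.
move/(congr1 (fun f => f.[0])); rewrite hornerM horner_exp [in RHS]hornerD hornerN.
by rewrite !csum_deformed /q_def !hornerE.
Qed.

Lemma bsum_swap (D : {set T}) p s :
  {in D &, forall i j, i != j -> pole q x i j != 0} -> #|D| = (p + s)%N ->
  bsum q x D p s p.+1 = q ^+ minn p s * bsum q x D s p.+1 s.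
Proof.
move=> pole0 cD; apply: (mulIf (prod_pole_neq0 pole0)).
by rewrite -mulrA !bsum_csum // csum_swap.
Qed.

Lemma bsum_exchange (D : {set T}) p :
  {in D &, forall i j, i != j -> pole q x i j != 0} -> #|D| = (p.+1 + p.+1)%N ->
  q ^+ p.+1 * bsum q x D p.+1 2 0 = bsum q x D p.+1 1 1 - bsum q x D p.+2 0 2.
Proof.
move=> pole0 cD; apply: (mulIf (prod_pole_neq0 pole0)).
by rewrite mulrBl -mulrA !bsum_csum // csum_exchange.
Qed.

End Deformation.

Lemma generic_q0 (K : fieldType) r (q : K) (x : pt r.+1 K) :
  (0 < r)%N -> generic q x -> q != 0.
Proof.
move=> r0 [_ g]; apply/eqP => q0.
have nij : (ord0 : 'I_r.+1) != ord_max by rewrite -val_eqE /= eq_sym -lt0n.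
by have := g _ _ nij true true; rewrite q0 !mul0r eqxx.
Qed.

(** * Products of two operators, grouped by intersection and symmetric difference *)

Section Composition.
Variables (N : nat) (K : fieldType) (q : K) (x : pt N K).
Implicit Types (S D A B I J : {set 'I_N}) (n m : int).

Definition ratio (i j : 'I_N) := x i / (x i - x j).

(* The part of the coefficient of [Gamma_I Gamma_J] that depends only on
   [S = I :&: J] and on the symmetric difference [D] of [I] and [J]. *)
Definition common_coef S D : K := \prod_i \prod_j
  if i \in S then
    if j \in S then 1 else
    if j \in D then ratio i j else ratio i j * (q * x i / (q * x i - x j))
  else if (i \in D) && (j \notin S :|: D) then ratio i j else 1.

Definition double_shift S D : pt N K :=
  [ffun i => q ^+ ((i \in S).*2 + (i \in D)) * x i].

(** Here [A] is [I :\: J] and [D :\: A] is [J :\: I], so the two cardinality conditions say that [I]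
    has [a] elements and [J] has [b]. *)
Definition split_sum a b n m S D : K :=
  \sum_(A : {set 'I_N} | [&& A \subset D, #|S| + #|A| == a & #|S| + #|D :\: A| == b]%N)
    (\prod_(i in A) x i) ^ n * (\prod_(j in D :\: A) x j) ^ m *
    \prod_(i in A) \prod_(j in D :\: A) (x i * x j / pole q x i j).

Lemma double_prod_mkcond (A B : {set 'I_N}) (F : 'I_N -> 'I_N -> K) :
  \prod_(i in A) \prod_(j in B) F i j =
  \prod_i \prod_j if (i \in A) && (j \in B) then F i j else 1.
Proof.
rewrite big_mkcond; apply: eq_bigr => i _ /=.
by case: (i \in A) => /=; [rewrite big_mkcond | rewrite big1].
Qed.

Hypothesis gx : generic q x.

Lemma prod_x_neq0 A : \prod_(i in A) x i != 0.
Proof. by apply/prodf_neq0 => i _; case: gx. Qed.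

Lemma generic_pole_neq0 i j : i != j -> pole q x i j != 0.
Proof.
move=> nij; have [_ g] := gx; rewrite /pole mulf_neq0 // subr_eq0.
  by have := g i j nij false false; rewrite !mul1r.
by rewrite eq_sym; have := g i j nij true false; rewrite expr1 mul1r.
Qed.

Lemma coef_split S D A (y : pt N K) : [disjoint S & D] -> A \subset D ->
  y = [ffun i => if i \in S :|: A then q * x i else x i] ->
  (\prod_(i in S :|: A) \prod_(j in ~: (S :|: A)) (x i / (x i - x j))) *
  (\prod_(i in S :|: (D :\: A)) \prod_(j in ~: (S :|: (D :\: A))) (y i / (y i - y j)))
  = common_coef S D *
    \prod_(i in A) \prod_(j in D :\: A) (x i * x j / pole q x i j).
Proof.
move=> dSD sA ->; have [x0 g] := gx.
have -> : \prod_(i in A) \prod_(j in D :\: A) (x i * x j / pole q x i j) =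
  (\prod_(i in A) \prod_(j in D :\: A) ratio i j) *
  \prod_(i in D :\: A) \prod_(j in A) (x i / (x i - q * x j)).
  rewrite [X in _ * X]exchange_big -big_split; apply: eq_bigr => i _ /=.
  by rewrite -big_split; apply: eq_bigr => j _ /=; rewrite /ratio /pole invfM; ring.
(* All products now run over all ordered pairs, so the two sides are compared factor by factor,
   according to the membership of [i] and [j] in [S], [D] and [A]. *)
rewrite !double_prod_mkcond /common_coef -!big_split; apply: eq_bigr => i _ /=.
rewrite -!big_split; apply: eq_bigr => j _ /=; rewrite !ffunE !inE.
have SD k : k \in S -> k \in D = false by move=> kS; apply: (disjointFr dSD).
have AD k : k \in A -> k \in D by apply: (subsetP sA).
have [<-|nij] := eqVneq i j.
  move: (SD i) (AD i).
  by case: (i \in S); case: (i \in D); case: (i \in A) => //= h1 h2;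
    rewrite ?mulr1 //; have := h1 isT; have := h2 isT.
(* For [i] in [S] and [j] in [A] both coordinates are shifted. The ratio is unchanged, which makes
   this factor agree with the one for [j] in [D :\: A]. *)
have qr : q * x i / (q * x i - q * x j) = ratio i j.
  rewrite -mulrBr invfM mulrACA divff ?mul1r //.
  by have := g i j nij true true; apply: contra_neq => ->; rewrite !mul0r.
move: (SD i) (SD j) (AD i) (AD j).
case: (i \in S); case: (i \in D); case: (i \in A);
case: (j \in S); case: (j \in D); case: (j \in A) => //= h1 h2 h3 h4;
  rewrite ?mulr1 ?mul1r //;
  by [have := h1 isT | have := h2 isT | have := h3 isT | have := h4 isT].
Qed.

Lemma Mop_comp a b n m (f : fn N K) :
  Mop q a n (Mop q b m f) x =
  \sum_(P : {set 'I_N} * {set 'I_N} | [disjoint P.1 & P.2])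
    f (double_shift P.1 P.2) * common_coef P.1 P.2 *
    (\prod_(i in P.1) x i) ^ (n + m) * (q ^+ #|P.1|) ^ m *
    split_sum a b n m P.1 P.2.
Proof.
rewrite /Mop /GammaI; under eq_bigr => I _ do rewrite big_distrr /=.
rewrite pair_big_dep /=.
rewrite (partition_big (fun P : {set 'I_N} * {set 'I_N} =>
   (P.1 :&: P.2, (P.1 :\: P.2) :|: (P.2 :\: P.1)))
   (fun P => [disjoint P.1 & P.2])) /=; last first.
  move=> [I J] _ /=; rewrite disjoints_subset; apply/subsetP => i.
  by rewrite !inE => /andP[-> ->].
apply: eq_bigr => -[S D] /= dSD; rewrite /split_sum big_distrr /=.
have SD k : k \in S -> k \in D = false by move=> kS; apply: (disjointFr dSD).
(* Within the class of [(S, D)], the pair [(I, J)] is determined by [A = I :\: J]. *)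
rewrite (reindex_onto (fun A => (S :|: A, S :|: (D :\: A)))
  (fun P => P.1 :\: P.2)) /=; last first.
  move=> [I J] /= /andP[_ /eqP[<- <-]].
  by congr (_, _); apply/setP=> i; rewrite !inE; case: (i \in I); case: (i \in J).
have cardSU (B : {set 'I_N}) : B \subset D -> #|S :|: B| = (#|S| + #|B|)%N.
  move=> sB; rewrite cardsU disjoint_setI0 ?cards0 ?subn0 //.
  exact: disjointWr sB dSD.
have prodSU (y : 'I_N -> K) (B : {set 'I_N}) : B \subset D ->
    \prod_(i in S :|: B) y i = (\prod_(i in S) y i) * \prod_(i in B) y i.
  move=> sB; rewrite -bigU ?(disjointWr sB dSD) //.
  by apply: eq_bigl => i; rewrite !inE.
apply: eq_big => [A | A /andP[/andP[_ /eqP[eS eD]] /eqP eA]].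
  have [sA|nsA] /= := boolP (A \subset D).
    have -> : (S :|: A) :&: (S :|: (D :\: A)) = S.
      by apply/setP=> i; rewrite !inE; case: (i \in S); case: (i \in A).
    have eA : (S :|: A) :\: (S :|: (D :\: A)) = A.
      apply/setP=> i; rewrite !inE; move: (SD i) (subsetP sA i).
      by case: (i \in S); case: (i \in A); case: (i \in D) => //= h1 h2;
        [have := h1 isT | have := h2 isT].
    have eB : (S :|: (D :\: A)) :\: (S :|: A) = D :\: A.
      apply/setP=> i; rewrite !inE; move: (SD i).
      by case: (i \in S); case: (i \in A); case: (i \in D) => //= h1; have := h1 isT.
    have -> : (S :|: A) :\: (S :|: (D :\: A)) :|: (S :|: (D :\: A)) :\: (S :|: A) = D.
      by rewrite eA eB -{1}(setIidPr sA) setID.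
    by rewrite eA !eqxx !andbT !cardSU // subsetDl.
  apply/negP => /andP[/andP[_ /eqP[_ eD]] /eqP eA]; case/negP: nsA.
  by apply/subsetP => i iA; rewrite -eD in_setU eA iA.
have sA : A \subset D by apply/subsetP => i iA; rewrite -eD in_setU eA iA.
set y : pt N K := [ffun i => if i \in S :|: A then q * x i else x i].
have := coef_split dSD sA (erefl y).
set cI := \prod_(i in S :|: A) _; set cJ := \prod_(i in S :|: (D :\: A)) _ => cE.
have sB : D :\: A \subset D by apply: subsetDl.
have yS : \prod_(i in S) y i = q ^+ #|S| * \prod_(i in S) x i.
  rewrite -prodr_const -big_split /=; apply: eq_bigr => i iS.
  by rewrite ffunE inE iS.
have yB : \prod_(i in D :\: A) y i = \prod_(i in D :\: A) x i.
  apply: eq_bigr => i; rewrite inE => /andP[iA iD]; rewrite ffunE inE (negPf iA).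
  by case: ifP => // /orP[/SD|//]; rewrite iD.
have -> : [ffun i => if i \in S :|: (D :\: A) then q * y i else y i] = double_shift S D.
  apply/ffunP => i; rewrite !ffunE !inE; move: (SD i) (subsetP sA i).
  case: (i \in S); case: (i \in A); case: (i \in D) => //= h1 h2;
   by [rewrite ?expr0 ?expr1 ?expr2 ?mul1r ?mulrA | have := h1 isT | have := h2 isT].
rewrite !prodSU // yS yB !expfzMl expfzDr ?prod_x_neq0 //.
transitivity (cI * cJ * ((\prod_(i in S) x i) ^ n * (\prod_(i in A) x i) ^ n *
  ((q ^+ #|S|) ^ m * (\prod_(i in S) x i) ^ m * (\prod_(i in D :\: A) x i) ^ m) *
   f (double_shift S D))); first by ring.
rewrite cE; ring.
Qed.

Lemma split_sum_eq0 a b n m S D :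
  ~~ [&& #|S| <= a, #|S| <= b & #|D| + #|S|.*2 == a + b]%N ->
  split_sum a b n m S D = 0.
Proof.
move=> h; rewrite /split_sum big_pred0 // => A; apply: contraNF h.
case/and3P => sA /eqP <- /eqP <-; rewrite !leq_addr /= cardsDS //.
by move: (subset_leq_card sA); move: #|A| #|D| #|S| => c d k ?; apply/eqP; lia.
Qed.

(** The numerators [x i * x j] raise each variable of [A] to [s] further powers and each variable of
    [D :\: A] to [p] further powers. *)
Lemma split_sum_bsum p s l u v S D : #|D| = (p + s)%N ->
  split_sum (#|S| + p) (#|S| + s) (l + u%:Z) (l + v%:Z) S D =
  (\prod_(i in D) x i) ^ l * bsum q x D p (u + s) (v + p).
Proof.
move=> cD; rewrite /split_sum /bsum big_distrr /=; apply: eq_big => [A | A /and3P[sA]].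
  case: (boolP (A \subset D)) => //= sA; rewrite !eqn_add2l cardsDS // cD.
  by apply: andb_idr => /eqP ->; rewrite addKn.
rewrite !eqn_add2l => /eqP cA /eqP cB.
have -> : \prod_(i in A) \prod_(j in D :\: A) (x i * x j / pole q x i j) =
    (\prod_(i in A) x i) ^+ s * (\prod_(j in D :\: A) x j) ^+ p *
    \prod_(i in A) \prod_(j in D :\: A) (pole q x i j)^-1.
  rewrite -{1}cB -{1}cA -prodrXl -prodr_const -!big_split /=; apply: eq_bigr => i _.
  by rewrite -prodr_const -!big_split.
rewrite [\prod_(i in D) _](big_setID A) /= (setIidPr sA) /bterm.
rewrite expfzMl !expfzDr ?prod_x_neq0 // -!exprnP !exprD; ring.
Qed.

Hypothesis q0 : q != 0.

(** With a = |S| + p and b = |S| + s, the inner shift on [S] supplies [q ^+ #|S|] and [bsum_swap]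
    supplies [q ^+ minn p s]; together they give [q ^+ minn a b]. *)
Lemma split_sum_swap a b n S D :
  (q ^+ #|S|) ^ (n + 1) * split_sum a b n (n + 1) S D =
  q ^+ minn a b * ((q ^+ #|S|) ^ n * split_sum b a (n + 1) n S D).
Proof.
have [/and3P[Sa Sb /eqP cD] | h] :=
  boolP [&& #|S| <= a, #|S| <= b & #|D| + #|S|.*2 == a + b]%N; last first.
  rewrite !split_sum_eq0 ?mulr0 //.
  by rewrite andbCA [(b + a)%N]addnC.
have [p ea] : exists p, a = (#|S| + p)%N by exists (a - #|S|)%N; rewrite subnKC.
have [s eb] : exists s, b = (#|S| + s)%N by exists (b - #|S|)%N; rewrite subnKC.
have cDps : #|D| = (p + s)%N.
  by move: cD; rewrite ea eb; move: #|S| #|D| => k d; lia.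
have cDsp : #|D| = (s + p)%N by rewrite addnC.
have := split_sum_bsum n 0 1 S cDps; have := split_sum_bsum n 1 0 S cDsp.
rewrite addr0 ea eb => -> ->; rewrite !add0n !add1n.
rewrite (bsum_swap _ cDps); last by move=> i j _ _; apply: generic_pole_neq0.
rewrite -addn_minr exprD expfzDr ?expf_neq0 // -exprnP; ring.
Qed.

Lemma split_sum_exchange a n S D : (0 < a)%N ->
  q ^+ a * ((q ^+ #|S|) ^ (n - 1) * split_sum a a (n + 1) (n - 1) S D) =
  (q ^+ #|S|) ^ n * split_sum a a n n S D -
  (q ^+ #|S|) ^ n * split_sum a.+1 a.-1 n n S D.
Proof.
case: a => [//|a] _ /=; have [l ->] : exists l, n = l + 1 by exists (n - 1); rewrite subrK.
rewrite addrK expfzDr ?expf_neq0 // -exprnP.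
have [/andP[Sa /eqP cD] | h] :=
  boolP [&& #|S| <= a.+1 & #|D| + #|S|.*2 == a.+1 + a.+1]%N; last first.
  rewrite !(@split_sum_eq0 a.+1) ?andbA ?andbb // split_sum_eq0 ?mulr0 ?subrr //.
  apply: contra h => /and3P[_ Sa e].
  by rewrite (leq_trans Sa) //= addnS -addSn.
have [p ea] : exists p, a.+1 = (#|S| + p)%N by exists (a.+1 - #|S|)%N; rewrite subnKC.
have cDp : #|D| = (p + p)%N by move: cD; rewrite ea; move: #|S| #|D| => k d; lia.
have e20 : split_sum a.+1 a.+1 (l + 1 + 1) l S D =
    (\prod_(i in D) x i) ^ l * bsum q x D p (2 + p) (0 + p).
  by rewrite -(split_sum_bsum _ _ _ S cDp) addr0 -addrA ea.
have e11 : split_sum a.+1 a.+1 (l + 1) (l + 1) S D =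
    (\prod_(i in D) x i) ^ l * bsum q x D p (1 + p) (1 + p).
  by rewrite -(split_sum_bsum _ _ _ S cDp) ea.
rewrite e20 e11 !bsum_shiftn.
(* If [p] is 0 then [D] is empty and [S] has [a.+1] elements, too many for an operator of index [a];
   the last sum vanishes and only powers of [q] are compared. *)
case: p ea cDp {e20 e11} => [|p] ea cDp.
  rewrite split_sum_eq0 ?bsum0 ?(cards0_eq cDp) ?big_set0.
    by rewrite !expr1n ea addn0; ring.
  have -> : (#|S| <= a)%N = false by rewrite leqNgt ea addn0 leqnn.
  by rewrite andbF.
have cDp1 : #|D| = (p.+2 + p)%N by rewrite cDp addnS.
(* The sides have sizes [p.+2] and [p], so the absorbed numerators turn the equal exponents 1 and 1
   into [p.+1] and [p.+3]; removing [p.+1] from both leaves 0 and 2. *)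
have -> : split_sum a.+2 a (l + 1) (l + 1) S D =
    (\prod_(i in D) x i) ^ l * bsum q x D p.+2 (0 + p.+1) (2 + p.+1).
  have e2 : a.+2 = (#|S| + p.+2)%N by rewrite ea !addnS.
  have e0 : a = (#|S| + p)%N by apply/eqP; rewrite -eqSS ea addnS.
  by rewrite e2 [X in split_sum _ X _ _ _ _]e0 (split_sum_bsum _ 1 1 S cDp1).
rewrite bsum_shiftn.
have -> : bsum q x D p.+1 1 1 = q ^+ p.+1 * bsum q x D p.+1 2 0 + bsum q x D p.+2 0 2.
  by rewrite (bsum_exchange _ cDp) ?subrK // => i j _ _; apply: generic_pole_neq0.
by rewrite ea exprD; ring.
Qed.

End Composition.

Theorem theorem4p2 (K : fieldType) (r : nat) (q : K) (f : fn r.+1 K) :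
  symmetric_fn f ->
  (forall (n : int) (x : pt r.+1 K),
      Mop q r.+1 n f x = (\prod_i x i) ^ n * GammaI q setT f x) /\
  (forall (a b : nat) (n : int) (x : pt r.+1 K),
      (1 <= a <= r)%N -> (1 <= b <= r)%N -> generic q x ->
      Mop q a n (Mop q b (n + 1) f) x
        = q ^+ minn a b * Mop q b (n + 1) (Mop q a n f) x) /\
  (forall (a : nat) (n : int) (x : pt r.+1 K),
      (1 <= a <= r)%N -> generic q x ->
      q ^+ a * Mop q a (n + 1) (Mop q a (n - 1) f) x
        = Mop q a n (Mop q a n f) x - Mop q a.+1 n (Mop q a.-1 n f) x).
Proof.
move=> _; split; [|split].
- move=> n x; rewrite /Mop (big_pred1 setT) => [|I].
    rewrite [X in _ * X * _]big1 ?mulr1 => [|i _]; last by rewrite setCT big_set0.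
    by congr (_ ^ n * _); apply: eq_bigl => i; rewrite inE.
  apply/eqP/eqP => [cI|->]; last by rewrite cardsT card_ord.
  by apply/eqP; rewrite eqEcard subsetT cardsT card_ord cI leqnn.
- move=> a b n x /andP[a0 ar] _ gx; have q0 := generic_q0 (leq_trans a0 ar) gx.
  rewrite !Mop_comp // big_distrr /=.
  (* For each [(S, D)] both products share the value of [f], [common_coef] and the power of x_S;
     only the split sums and the powers of [q] differ. *)
  apply: eq_bigr => -[S D] _ /=; rewrite [(n + 1 + n)]addrC.
  by rewrite -!mulrA (split_sum_swap gx q0); ring.
- move=> a n x /andP[a0 ar] gx; have q0 := generic_q0 (leq_trans a0 ar) gx.
  rewrite !Mop_comp // big_distrr -sumrB /=.
  apply: eq_bigr => -[S D] _ /=; have -> : n + 1 + (n - 1) = n + n.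
    by rewrite addrACA subrr addr0.
  set w := f _ * _ * _; have e := split_sum_exchange gx q0 n S D a0.
  transitivity (w * (q ^+ a * ((q ^+ #|S|) ^ (n - 1) *
    split_sum q x a a (n + 1) (n - 1) S D))); first by ring.
  by rewrite e; ring.
Qed.
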